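(* Let $\rho,\tau\in\mathbb R\cup\{\infty\}$, and let $T$ be a non-equilateral oriented triangle. The triangles $\mathcal C_\rho(T)$ and $\mathcal C_\tau(T)$ are directly similar if and only if $\tau\in\rho\,\square\,\mathbb S$. For $\rho\in\mathbb R\setminus\{0\}$, the ratio of similarity of $\mathcal C_\rho(T)$ to $\mathcal C_{\rho\square\infty}(T)$ is $|\rho|$. For $\rho\in\mathbb R\setminus\{1\}$, the ratio of similarity of $\mathcal C_\rho(T)$ to $\mathcal C_{\rho\square1}(T)$ is $|1-\rho|$.
   Context: An oriented triangle is written as the ordered triple $T=(a,b,c)$ of its side lengths taken counterclockwise (positive reals with $|a-b|<c<a+b$). Oriented triangles $(a,b,c)$ and $(x,y,z)$ are directly similar if $\frac ax=\frac by=\frac cz$ or $\frac ay=\frac bz=\frac cx$ or $\frac az=\frac bx=\frac cy$; the common ratio is the ratio of similarity of $(a,b,c)$ to $(x,y,z)$. Ceva's operators: for $\rho\in\mathbb R$, $\mathcal C_\rho(a,b,c)=(x_\rho,y_\rho,z_\rho)$ with $x_\rho=\sqrt{\rho a^2+(1-\rho)b^2+\rho(\rho-1)c^2}$, $y_\rho=\sqrt{(1-\rho)a^2+\rho(\rho-1)b^2+\rho c^2}$, $z_\rho=\sqrt{\rho(\rho-1)a^2+\rho b^2+(1-\rho)c^2}$ (again side lengths of an oriented triangle); $\mathcal C_\infty(a,b,c)=(c,b,a)$. The commutative group operation $\square$ on $\mathbb R\cup\{\infty\}$ (identity $0$): for $\rho,\tau\in\mathbb R$, $\rho\,\square\,\tau=\frac{\rho+\tau-\rho\tau}{1-\rho\tau}$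 if $\rho\tau\ne1$ and $\rho\,\square\,\tau=\infty$ if $\rho\tau=1$; $\rho\,\square\,\infty=\infty\,\square\,\rho=1-\frac1\rho$ for $\rho\in\mathbb R\setminus\{0\}$; $0\,\square\,\infty=\infty\,\square\,0=\infty$; $\infty\,\square\,\infty=1$. $\mathbb S=\{0,1,\infty\}$ is a subgroup, and $\rho\,\square\,\mathbb S=\{\rho\,\square\,\sigma:\sigma\in\mathbb S\}$. *)

(* Defs.v *)
From HB Require Import structures.
From mathcomp Require Import all_boot all_order all_algebra.
From mathcomp Require Import ring lra.
From mathcomp Require Import classical_sets reals.

Set Implicit Arguments.
Unset Strict Implicit.
Unset Printing Implicit Defensive.

Import Order.TTheory GRing.Theory Num.Theory.
Local Open Scope ring_scope.

(* Side lengths are listed counterclockwise, so the order of the fields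
   carries the orientation. *)
Record otriangle (R : realType) := OTriangle {
  side1 : R;
  side2 : R;
  side3 : R;
  side1_gt0 : 0 < side1;
  side2_gt0 : 0 < side2;
  side3_gt0 : 0 < side3;
  triangle_ineq : `|side1 - side2| < side3 < side1 + side2
}.

Definition equilateral (R : realType) (T : otriangle R) : Prop :=
  side1 T = side2 T /\ side2 T = side3 T.

Definition directly_similar (R : realType) (T U : otriangle R) : Prop :=
  let: (a, b, c) := (side1 T, side2 T, side3 T) in
  let: (x, y, z) := (side1 U, side2 U, side3 U) in
  [\/ a / x = b / y /\ b / y = c / z,
      a / y = b / z /\ b / z = c / x
    | a / z = b / x /\ b / x = c / y].

(* [T] and [U] are directly similar and the common ratio is [k]; [k] is
   determined by [T] and [U], see [similarity_ratio_unique]. *)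
Definition similarity_ratio (R : realType) (T U : otriangle R) (k : R) : Prop :=
  let: (a, b, c) := (side1 T, side2 T, side3 T) in
  let: (x, y, z) := (side1 U, side2 U, side3 U) in
  [\/ [/\ a / x = k, b / y = k & c / z = k],
      [/\ a / y = k, b / z = k & c / x = k]
    | [/\ a / z = k, b / x = k & c / y = k]].

Lemma similarity_ratio_unique (R : realType) (T U : otriangle R) (k l : R) :
  similarity_ratio T U k -> similarity_ratio T U l -> k = l.
Proof.
have perim m : similarity_ratio T U m ->
    m = (side1 T + side2 T + side3 T) / (side1 U + side2 U + side3 U).
  case: U => x y z x0 y0 z0 hU; rewrite /similarity_ratio /= => h.
  have s0 : x + y + z != 0 by rewrite gt_eqF // !addr_gt0.
  have e u v : 0 < v -> u / v = m -> u = m * v.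
    by move=> v0 <-; rewrite divfK // gt_eqF.
  apply: (mulIf s0); rewrite divfK //.
  by case: h => -[] /e h1 /e h2 /e h3; rewrite h1 // h2 // h3 //; ring.
by move=> /perim -> /perim ->.
Qed.

Lemma directly_similarP (R : realType) (T U : otriangle R) :
  directly_similar T U <-> exists k, similarity_ratio T U k.
Proof.
rewrite /directly_similar /similarity_ratio; split.
  case=> -[h1 h2].
  - by exists (side1 T / side1 U); apply: Or31; rewrite -h2 -h1.
  - by exists (side1 T / side2 U); apply: Or32; rewrite -h2 -h1.
  - by exists (side1 T / side3 U); apply: Or33; rewrite -h2 -h1.
by case=> k [] [-> -> ->]; [apply: Or31|apply: Or32|apply: Or33].
Qed.

(* Sixteen times the squared area, as a function of the squared sides. *)
Definition heron (R : realType) (p q r : R) : R :=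
  4 * p * q - (p + q - r) ^+ 2.

Lemma heron_gt0 (R : realType) (a b c : R) :
  0 < a -> 0 < b -> 0 < c -> `|a - b| < c < a + b ->
  0 < heron (a ^+ 2) (b ^+ 2) (c ^+ 2).
Proof.
move=> a0 b0 c0 /andP[]; rewrite ltr_norml => /andP[h1 h2] h3.
have -> : heron (a ^+ 2) (b ^+ 2) (c ^+ 2) =
    (a + b + c) * (a + b - c) * ((c + a - b) * (c + b - a)).
  by rewrite /heron; ring.
by rewrite !mulr_gt0 //; lra.
Qed.

Lemma heron_triangle (R : realType) (x y z : R) :
  0 < x -> 0 < y -> 0 < z -> 0 < heron (x ^+ 2) (y ^+ 2) (z ^+ 2) ->
  `|x - y| < z < x + y.
Proof.
move=> x0 y0 z0 h.
have hE : heron (x ^+ 2) (y ^+ 2) (z ^+ 2) =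
    (z ^+ 2 - (x - y) ^+ 2) * ((x + y) ^+ 2 - z ^+ 2) by rewrite /heron; ring.
rewrite hE in h.
have xy0 : 0 < x * y by exact: mulr_gt0.
have dE : (x + y) ^+ 2 - (x - y) ^+ 2 = 4 * (x * y) by ring.
have [u v] : 0 < z ^+ 2 - (x - y) ^+ 2 /\ 0 < (x + y) ^+ 2 - z ^+ 2.
  have [u|u] := ltP 0 (z ^+ 2 - (x - y) ^+ 2).
    by split=> //; rewrite -(pmulr_rgt0 _ u).
  have v : 0 < (x + y) ^+ 2 - z ^+ 2 by lra.
  by move: h; rewrite pmulr_lgt0 // ltNge u.
apply/andP; split.
  rewrite -(@ltr_pXn2r _ 2) ?nnegrE ?normr_ge0 ?ltW //.
  by rewrite real_normK ?num_real //; lra.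
by rewrite -(@ltr_pXn2r _ 2) ?nnegrE ?addr_ge0 ?ltW //; lra.
Qed.

(* Squared length of a cevian; it is positive since the discriminant of this
   quadratic polynomial in [rho] is [- heron]. *)
Lemma stewart_gt0 (R : realType) (a b c rho : R) :
  0 < c -> 0 < heron (a ^+ 2) (b ^+ 2) (c ^+ 2) ->
  0 < rho * a ^+ 2 + (1 - rho) * b ^+ 2 + rho * (rho - 1) * c ^+ 2.
Proof.
move=> c0 h; have cc : 0 < 4 * c ^+ 2 by rewrite mulr_gt0 ?exprn_gt0.
rewrite -(pmulr_rgt0 _ cc).
have -> : 4 * c ^+ 2 *
    (rho * a ^+ 2 + (1 - rho) * b ^+ 2 + rho * (rho - 1) * c ^+ 2) =
    (2 * rho * c ^+ 2 + a ^+ 2 - b ^+ 2 - c ^+ 2) ^+ 2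
    + heron (a ^+ 2) (b ^+ 2) (c ^+ 2) by rewrite /heron; ring.
by rewrite ltr_wpDl // sqr_ge0.
Qed.

Section Ceva.
Variables (R : realType) (rho : R) (T : otriangle R).

Let a := side1 T.
Let b := side2 T.
Let c := side3 T.

Definition ceva_x : R :=
  Num.sqrt (rho * a ^+ 2 + (1 - rho) * b ^+ 2 + rho * (rho - 1) * c ^+ 2).
Definition ceva_y : R :=
  Num.sqrt ((1 - rho) * a ^+ 2 + rho * (rho - 1) * b ^+ 2 + rho * c ^+ 2).
Definition ceva_z : R :=
  Num.sqrt (rho * (rho - 1) * a ^+ 2 + rho * b ^+ 2 + (1 - rho) * c ^+ 2).

Let h : 0 < heron (a ^+ 2) (b ^+ 2) (c ^+ 2).
Proof.
exact: heron_gt0 (side1_gt0 T) (side2_gt0 T) (side3_gt0 T) (triangle_ineq T).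
Qed.

Let x2_gt0 :
  0 < rho * a ^+ 2 + (1 - rho) * b ^+ 2 + rho * (rho - 1) * c ^+ 2.
Proof. exact: stewart_gt0 (side3_gt0 T) h. Qed.

Let y2_gt0 :
  0 < (1 - rho) * a ^+ 2 + rho * (rho - 1) * b ^+ 2 + rho * c ^+ 2.
Proof.
have h' : 0 < heron (c ^+ 2) (a ^+ 2) (b ^+ 2).
  by move: h; congr (0 < _); rewrite /heron; ring.
by have := stewart_gt0 rho (side2_gt0 T) h'; congr (0 < _); rewrite -/b; ring.
Qed.

Let z2_gt0 :
  0 < rho * (rho - 1) * a ^+ 2 + rho * b ^+ 2 + (1 - rho) * c ^+ 2.
Proof.
have h' : 0 < heron (b ^+ 2) (c ^+ 2) (a ^+ 2).
  by move: h; congr (0 < _); rewrite /heron; ring.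
by have := stewart_gt0 rho (side1_gt0 T) h'; congr (0 < _); rewrite -/a; ring.
Qed.

Lemma ceva_x_gt0 : 0 < ceva_x. Proof. by rewrite sqrtr_gt0. Qed.
Lemma ceva_y_gt0 : 0 < ceva_y. Proof. by rewrite sqrtr_gt0. Qed.
Lemma ceva_z_gt0 : 0 < ceva_z. Proof. by rewrite sqrtr_gt0. Qed.

Lemma ceva_triangle_ineq : `|ceva_x - ceva_y| < ceva_z < ceva_x + ceva_y.
Proof.
apply: heron_triangle ceva_x_gt0 ceva_y_gt0 ceva_z_gt0 _.
rewrite !sqr_sqrtr ?ltW //.
set X := (X in heron X _ _); set Y := (Y in heron _ Y _).
set Z := (Z in heron _ _ Z).
have -> : heron X Y Z =
    (1 - rho + rho ^+ 2) ^+ 2 * heron (a ^+ 2) (b ^+ 2) (c ^+ 2).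
  by rewrite /X /Y /Z /heron; ring.
rewrite mulr_gt0 // exprn_gt0 //.
have -> : 1 - rho + rho ^+ 2 = (rho - 1 / 2) ^+ 2 + 3 / 4 by field.
by rewrite ltr_wpDl ?sqr_ge0 //; lra.
Qed.

Definition ceva_fin : otriangle R :=
  OTriangle ceva_x_gt0 ceva_y_gt0 ceva_z_gt0 ceva_triangle_ineq.

Lemma rev_triangle_ineq : `|c - b| < a < c + b.
Proof.
have := triangle_ineq T; rewrite -/a -/b -/c !ltr_norml.
by move=> /andP[/andP[h1 h2] h3]; apply/andP; split; [apply/andP; split|]; lra.
Qed.

Definition ceva_infty : otriangle R :=
  OTriangle (side3_gt0 T) (side2_gt0 T) (side1_gt0 T) rev_triangle_ineq.

End Ceva.

(* The set R \cup {\infty} is [option R], with [None] as the point at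
   infinity. *)
Definition ceva (R : realType) (rho : option R) (T : otriangle R) :
    otriangle R :=
  if rho is Some r then ceva_fin r T else ceva_infty T.

Definition box (R : realType) (rho tau : option R) : option R :=
  match rho, tau with
  | Some r, Some t =>
      if r * t == 1 then None else Some ((r + t - r * t) / (1 - r * t))
  | Some r, None | None, Some r => if r == 0 then None else Some (1 - 1 / r)
  | None, None => Some 1
  end.

Definition boxS {R : realType} : set (option R) :=
  [set Some 0; Some 1; None]%classic.

Definition box_coset (R : realType) (rho : option R) (A : set (option R)) :
    set (option R) :=
  [set box rho sigma | sigma in A]%classic.

(* Main.v *)
Require Import Defs.
From mathcomp Require Import all_boot all_order all_algebra.
From mathcomp Require Import ring lra.
From mathcomp Require Import classical_sets reals.

Set Implicit Arguments.
Unset Strict Implicit.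
Unset Printing Implicit Defensive.

Import Order.TTheory GRing.Theory Num.Theory.
Local Open Scope ring_scope.

(** Write [rho] as a ratio [r / s], with [1 / 0] for infinity. After
    multiplication by [s ^+ 2], the squared sides of the image of a triangle
    with squared sides [A], [B], [C] become the three values of one form
      [r s A + s (s - r) B + r (r - s) C]
    under the cyclic shifts of [A], [B], [C]; at [(1, 0)] these values are the
    squared sides of the image under infinity. The map [turn],
    [(r, s) |-> (r - s, r)], whose cube is [- 1], permutes the coefficients of
    the form cyclically ([cevian_turn]). On ratios, [turn] is the translation by
    infinity for the group law, and its square is the translation by [1]
    ([turn_ratio], [turn2_ratio]). So the images under [rho] and under its
    translates have the same sides up to rotation and scale. The scale is the
    factor between the turned coordinates of [rho] and the normalized ones of
    its translate; when [rho] and the translate are finite, this factor is, up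
    to sign, [rho] for infinity and [1 - rho] for [1].

    Conversely, after undoing the rotation with [turn], two similar images have
    proportional squared sides in the given order. The form determines the ratio
    [r / s] unless [A = B = C] ([cevian_inj]): the sum of the squared sides
    gives the factor of proportionality, and what remains is a linear system in
    [A - C], [B - C] whose determinant is, up to sign, [(r s' - r' s) ^+ 2]
    times two positive norms [r ^+ 2 - r s + s ^+ 2]. *)

(** * Homogeneous coordinates for the parameter *)

Section Coordinates.
Variable R : realType.
Implicit Types (p q : R * R) (rho tau : option R) (A B C k l : R).

Definition ratio rho : R * R := if rho is Some r then (r, 1) else (1, 0).

Definition scale k p : R * R := (k * p.1, k * p.2).

Definition turn p : R * R := (p.1 - p.2, p.1).

(** The norm from the Eisenstein integers, of [p.1 + w * p.2] with [w] a
    primitive cube root of unity; [turn] multiplies by a unit. *)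
Definition enorm p : R := p.1 ^+ 2 - p.1 * p.2 + p.2 ^+ 2.

(** Stewart's formula for the squared length of a cevian, homogenized in the
    parameter, so that infinity needs no separate treatment. *)
Definition cevian p A B C : R :=
  p.1 * p.2 * A + p.2 * (p.2 - p.1) * B + p.1 * (p.1 - p.2) * C.

Lemma cevian_turn p A B C : cevian (turn p) A B C = cevian p B C A.
Proof. by rewrite /cevian /turn /=; ring. Qed.

Lemma cevian_scale k p A B C :
  cevian (scale k p) A B C = k ^+ 2 * cevian p A B C.
Proof. by rewrite /cevian /scale /=; ring. Qed.

Lemma enorm_turn p : enorm (turn p) = enorm p.
Proof. by rewrite /enorm /turn /=; ring. Qed.

Lemma enorm_ratio rho : enorm (ratio rho) != 0.
Proof.
rewrite gt_eqF //; case: rho => [r|]; rewrite /enorm /=; last by lra.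
have -> : r ^+ 2 - r * 1 + 1 ^+ 2 = (r - 1 / 2) ^+ 2 + 3 / 4 by field.
by rewrite ltr_wpDl ?sqr_ge0 //; lra.
Qed.

Lemma ratio_inj rho tau :
  (ratio rho).1 * (ratio tau).2 = (ratio tau).1 * (ratio rho).2 -> rho = tau.
Proof.
case: rho tau => [r|] [t|] //=; rewrite ?mulr1 ?mulr0 ?mul1r.
- by move=> ->.
- by move=> /esym/eqP; rewrite oner_eq0.
- by move=> /eqP; rewrite oner_eq0.
Qed.

(** Pairs are compared only up to a factor, which is how the result of [turn]
    is recognized as the translate of a parameter. *)
Lemma ratio_inj_scale k p rho tau :
  p = scale k (ratio rho) -> enorm p != 0 ->
  p.1 * (ratio tau).2 = (ratio tau).1 * p.2 -> tau = rho.
Proof.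
move=> -> n0 /= e; apply/esym/ratio_inj.
have k0 : k != 0.
  by apply: contraNneq n0 => ->; rewrite /enorm /scale /=; apply/eqP; ring.
by apply: (mulfI k0); rewrite mulrA e; ring.
Qed.

(** * Translations by the subgroup of order three *)

Lemma box0 rho : box rho (Some 0) = rho.
Proof.
case: rho => [r|] /=; last by rewrite eqxx.
by rewrite mulr0 eq_sym oner_eq0 addr0 !subr0 divr1.
Qed.

Lemma turn_ratio_fin (r : R) : r != 0 ->
  turn (ratio (Some r)) = scale r (ratio (box (Some r) None)).
Proof.
by move=> r0; rewrite /turn /scale /= (negPf r0) /=; congr (_, _); field.
Qed.

Lemma turn2_ratio_fin (r : R) : r != 1 ->
  turn (turn (ratio (Some r)))
  = scale (- (1 - r)) (ratio (box (Some r) (Some 1))).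
Proof.
move=> r1; rewrite /turn /scale /= mulr1 (negPf r1) /=.
have d0 : 1 - r != 0 by rewrite subr_eq0 eq_sym.
by congr (_, _); field.
Qed.

Lemma turn_ratio rho :
  exists k, turn (ratio rho) = scale k (ratio (box rho None)).
Proof.
case: rho => [r|]; last first.
  by exists 1; rewrite /turn /scale /=; congr (_, _); ring.
have [->|r0] := eqVneq r 0; last by exists r; exact: turn_ratio_fin.
by exists (-1); rewrite /turn /scale /= eqxx /=; congr (_, _); ring.
Qed.

Lemma turn2_ratio rho :
  exists k, turn (turn (ratio rho)) = scale k (ratio (box rho (Some 1))).
Proof.
case: rho => [r|]; last first.
  by exists 1; rewrite /turn /scale /= oner_eq0 /=; congr (_, _); field.
have [->|r1] := eqVneq r 1; last by exists (- (1 - r)); exact: turn2_ratio_fin.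
by exists (-1); rewrite /turn /scale /= mulr1 eqxx /=; congr (_, _); ring.
Qed.

(** * The cevian form determines the ratio *)

(** The hypotheses give a linear system in [A - C] and [B - C] with matrix
    [v1, v2; v2, - v1 - v2]. Its determinant is minus a value of the norm form,
    which is multiplicative, so it factors through [enorm p * enorm q] and can
    vanish only with [d]. *)
Lemma cevian_inj p q A B C l :
  enorm p != 0 -> enorm q != 0 -> A + B + C != 0 -> ~ (A = B /\ B = C) ->
  cevian p A B C = l * cevian q A B C ->
  cevian p B C A = l * cevian q B C A ->
  cevian p C A B = l * cevian q C A B ->
  p.1 * q.2 = q.1 * p.2.
Proof.
move=> p0 q0 S0 neq e1 e2 e3.
have sumE u :
    cevian u A B C + cevian u B C A + cevian u C A B = enorm u * (A + B + C).
  by rewrite /cevian /enorm; ring.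
have nE : enorm p = l * enorm q.
  by apply: (mulIf S0); rewrite -mulrA -!sumE e1 e2 e3; ring.
pose d := p.1 * q.2 - q.1 * p.2.
(* The coefficients of [A], [B] in [enorm q * cevian p - enorm p * cevian q];
   that of [C] is [- v1 - v2]. *)
pose v1 := d * (p.2 * q.2 - p.1 * q.1).
pose v2 := d * (p.1 * q.1 - p.1 * q.2 - q.1 * p.2).
have vE X Y Z : cevian p X Y Z = l * cevian q X Y Z ->
    v1 * (X - Z) + v2 * (Y - Z) = 0.
  move=> e; transitivity (enorm q * cevian p X Y Z - enorm p * cevian q X Y Z).
    by rewrite /v1 /v2 /d /cevian /enorm; ring.
  by rewrite e nE; ring.
have := vE _ _ _ e1; have := vE _ _ _ e3 => {e1 e2 e3} f3 f1.
have detE : v1 ^+ 2 + v1 * v2 + v2 ^+ 2 = d ^+ 2 * (enorm p * enorm q).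
  by rewrite /v1 /v2 /d /enorm; ring.
have zero X : d ^+ 2 * (enorm p * enorm q) * X = 0 -> d = 0 \/ X = 0.
  move=> /eqP; rewrite !mulf_eq0 (negPf p0) (negPf q0) !orbF orbb.
  by case/orP => /eqP; [left|right].
(* Cramer's rule for the two unknowns. *)
have hA : d ^+ 2 * (enorm p * enorm q) * (A - C) = 0.
  rewrite -detE; transitivity ((v1 + v2) * (v1 * (A - C) + v2 * (B - C))
    + v2 * (v1 * (C - B) + v2 * (A - B))); first by ring.
  by rewrite f1 f3; ring.
have hB : d ^+ 2 * (enorm p * enorm q) * (B - C) = 0.
  rewrite -detE; transitivity (v2 * (v1 * (A - C) + v2 * (B - C))
    - v1 * (v1 * (C - B) + v2 * (A - B))); first by ring.
  by rewrite f1 f3; ring.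
have [d0|AC] := zero _ hA; first exact: subr0_eq.
have [d0|BC] := zero _ hB; first exact: subr0_eq.
by case: neq; rewrite (subr0_eq AC) (subr0_eq BC).
Qed.

End Coordinates.

(** * Sides of the images *)

Section Images.
Variables (R : realType) (T : otriangle R).
Implicit Types (rho tau : option R) (k : R).

Let A := side1 T ^+ 2.
Let B := side2 T ^+ 2.
Let C := side3 T ^+ 2.

Lemma ceva_sides_sqr rho :
  [/\ side1 (ceva rho T) ^+ 2 = cevian (ratio rho) A B C,
      side2 (ceva rho T) ^+ 2 = cevian (ratio rho) C A B
    & side3 (ceva rho T) ^+ 2 = cevian (ratio rho) B C A].
Proof.
case: rho => [r|]; rewrite /cevian /=; last by split; rewrite /A /B /C; ring.
(* The square root of a negative number is [0], so positivity of the sides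
   already forces the radicands to be nonnegative. *)
have sqrE (x : R) : 0 < Num.sqrt x -> Num.sqrt x ^+ 2 = x.
  by rewrite sqrtr_gt0 => /ltW /sqr_sqrtr.
split; rewrite sqrE; first [by rewrite /A /B /C; ring | exact: ceva_x_gt0
  | exact: ceva_y_gt0 | exact: ceva_z_gt0].
Qed.

Lemma divr_norm_sqr (x y k : R) :
  0 < x -> 0 < y -> x ^+ 2 = k ^+ 2 * y ^+ 2 -> x / y = `|k|.
Proof.
move=> x0 y0 e; apply: (mulIf (lt0r_neq0 y0)); rewrite divfK ?lt0r_neq0 //.
apply/eqP; rewrite -(@eqrXn2 _ 2) //; [|exact: ltW|by rewrite mulr_ge0 // ltW].
by rewrite exprMn real_normK ?num_real // e.
Qed.

Lemma sqr_divr (x y k : R) : 0 < y -> x / y = k -> x ^+ 2 = k ^+ 2 * y ^+ 2.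
Proof. by move=> y0 <-; rewrite -exprMn divfK ?lt0r_neq0. Qed.

Let side_gt0 := (@side1_gt0 R, @side2_gt0 R, @side3_gt0 R).

Lemma similarity_ratio_turn rho tau k :
  turn (ratio rho) = scale k (ratio tau) ->
  similarity_ratio (ceva rho T) (ceva tau T) `|k|.
Proof.
move=> e; apply: Or32.
have [a b c] := ceva_sides_sqr rho; have [x y z] := ceva_sides_sqr tau.
by split; apply: divr_norm_sqr; rewrite ?side_gt0 //;
   rewrite ?(a, b, c) ?(x, y, z) -cevian_scale -e cevian_turn.
Qed.

Lemma similarity_ratio_turn2 rho tau k :
  turn (turn (ratio rho)) = scale k (ratio tau) ->
  similarity_ratio (ceva rho T) (ceva tau T) `|k|.
Proof.
move=> e; apply: Or33.
have [a b c] := ceva_sides_sqr rho; have [x y z] := ceva_sides_sqr tau.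
by split; apply: divr_norm_sqr; rewrite ?side_gt0 //;
   rewrite ?(a, b, c) ?(x, y, z) -cevian_scale -e !cevian_turn.
Qed.

Lemma sqr_sides_neq : ~ equilateral T -> ~ (A = B /\ B = C).
Proof.
have inj (x y : R) : 0 < x -> 0 < y -> x ^+ 2 = y ^+ 2 -> x = y.
  by move=> x0 y0 /eqP; rewrite eqrXn2 ?ltW // => /eqP.
by move=> hT [/inj AB /inj BC]; apply: hT; split; [apply: AB|apply: BC];
   rewrite side_gt0.
Qed.

(** Each way of matching the sides is reduced to the matching in the given order
    by applying a power of [turn] to the coordinates of [rho]. *)
Lemma similar_ceva_coset rho tau : ~ equilateral T ->
  directly_similar (ceva rho T) (ceva tau T) ->
  [\/ tau = box rho (Some 0), tau = box rho None | tau = box rho (Some 1)].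
Proof.
move=> /sqr_sides_neq neq /directly_similarP[k].
have S0 : A + B + C != 0.
  by rewrite lt0r_neq0 // !addr_gt0 // exprn_gt0 // side_gt0.
have np := enorm_ratio rho; have nq := enorm_ratio tau.
have [a b c] := ceva_sides_sqr rho; have [x y z] := ceva_sides_sqr tau.
have sq u v : 0 < v -> u / v = k -> u ^+ 2 = k ^+ 2 * v ^+ 2.
  by move=> v0; exact: sqr_divr.
case=> -[/sq e1 /sq e2 /sq e3];
  move: e1 e2 e3; rewrite !side_gt0 a b c x y z;
  move=> /(_ isT) e1 /(_ isT) e2 /(_ isT) e3.
- by apply: Or31; rewrite box0; apply/esym/ratio_inj;
     exact: (@cevian_inj _ _ _ A B C (k ^+ 2)).
- have [m em] := turn_ratio rho; apply: Or32.
  by apply: ratio_inj_scale em _ _; rewrite ?enorm_turn //;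
     apply: (@cevian_inj _ _ _ A B C (k ^+ 2));
     rewrite ?enorm_turn ?cevian_turn.
- have [m em] := turn2_ratio rho; apply: Or33.
  by apply: ratio_inj_scale em _ _; rewrite ?enorm_turn //;
     apply: (@cevian_inj _ _ _ A B C (k ^+ 2));
     rewrite ?enorm_turn ?cevian_turn.
Qed.

End Images.

Theorem theorem9p4 (R : realType) (T : otriangle R) (hT : ~ equilateral T) :
  [/\ forall rho tau : option R,
        directly_similar (ceva rho T) (ceva tau T) <->
        tau \in box_coset rho boxS,
      forall rho : R, rho != 0 ->
        similarity_ratio (ceva (Some rho) T) (ceva (box (Some rho) None) T)
          `|rho|
    & forall rho : R, rho != 1 ->
        similarity_ratio (ceva (Some rho) T) (ceva (box (Some rho) (Some 1)) T)
          `|1 - rho|].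
Proof.
split=> [rho tau|rho rho0|rho rho1]; first split.
- move=> /(similar_ceva_coset hT) h; rewrite in_setE.
  by case: h => ->; [exists (Some 0)|exists None|exists (Some 1)] => //;
     [left; left|right|left; right].
- rewrite in_setE => -[sigma [[]|] -> <-]; apply/directly_similarP.
  + rewrite box0; exists 1; apply: Or31.
    by rewrite !divff ?lt0r_neq0 ?side1_gt0 ?side2_gt0 ?side3_gt0.
  + have [k e] := turn2_ratio rho.
    by exists `|k|; exact: similarity_ratio_turn2.
  + have [k e] := turn_ratio rho.
    by exists `|k|; exact: similarity_ratio_turn.
- exact/similarity_ratio_turn/turn_ratio_fin.
- by rewrite -normrN; exact/similarity_ratio_turn2/turn2_ratio_fin.
Qed.
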